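(* Let $(C,o,\bullet,!)$ be a quadratic category, and let $L$ and $N$ be two objects of $C$. Then the contravariant functor from $C$ to the category of sets $$U\longmapsto \mathrm{Hom}_C(U\bullet L,\,N)$$ is representable by the object $N\,o\,L^!$.
   Context: Quadratic category: a category $C$ endowed with two tensor products (monoidal structures) $o$ and $\bullet$, with neutral objects $I_o$ and $I_\bullet$ and associativity constraints $c_o(U,V,W):(U\,o\,V)\,o\,W\to U\,o\,(V\,o\,W)$ and $c_\bullet(U,V,W):(U\bullet V)\bullet W\to U\bullet(V\bullet W)$, together with, for all objects $U,U_1,U_2,U_3$ of $C$, an object $U^!$ of $C$ (the quadratic dual of $U$) and morphisms $c_U:I_\bullet\to U\,o\,U^!$, $d_U:U^!\bullet U\to I_o$, $f_{U_1,U_2,U_3}:(U_1\,o\,U_2)\bullet U_3\to U_1\,o\,(U_2\bullet U_3)$, $h_{U_1,U_2,U_3}:U_1\bullet(U_2\,o\,U_3)\to(U_1\bullet U_2)\,o\,U_3$, such that for all objects and morphisms ($\circ$ denotes composition of morphisms): (i) $h_{U_1,U_2,U_3\bullet U_4}\circ(\mathrm{Id}_{U_1}\bullet f_{U_2,U_3,U_4})\circ c_\bullet(U_1,U_2\,o\,U_3,U_4)=f_{U_1\bullet U_2,U_3,U_4}\circ(h_{U_1,U_2,U_3}\bullet\mathrm{Id}_{U_4})$; (ii) $(\mathrm{Id}_{U_1}\,o\,h_{U_2,U_3,U_4})\circ f_{U_1,U_2,U_3\,o\,U_4}=c_o(U_1,U_2\bullet U_3,U_4)\circ(f_{U_1,U_2,U_3}\,o\,\mathrm{Id}_{U_4})\circ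 h_{U_1\,o\,U_2,U_3,U_4}$; (iii) $(\mathrm{Id}_U\,o\,d_U)\circ f_{U,U^!,U}\circ(c_U\bullet\mathrm{Id}_U):I_\bullet\bullet U\to U\,o\,I_o$ is $\mathrm{Id}_U$ after identifying source and target with $U$ by the unit isomorphisms; (iv) $(d_U\,o\,\mathrm{Id}_{U^!})\circ h_{U^!,U,U^!}\circ(\mathrm{Id}_{U^!}\bullet c_U):U^!\bullet I_\bullet\to I_o\,o\,U^!$ is $\mathrm{Id}_{U^!}$ after identifying source and target with $U^!$ by the unit isomorphisms; (v) for $u_i:U_i\to U_i'$ ($i=1,2,3$): $h_{U_1',U_2',U_3'}\circ(u_1\bullet(u_2\,o\,u_3))=((u_1\bullet u_2)\,o\,u_3)\circ h_{U_1,U_2,U_3}$ and $f_{U_1',U_2',U_3'}\circ((u_1\,o\,u_2)\bullet u_3)=(u_1\,o\,(u_2\bullet u_3))\circ f_{U_1,U_2,U_3}$.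
   Formalization: From axioms (i)–(v) alone the claim is false; the formal theorem additionally assumes that, under the right unit isomorphisms, the morphisms h_{U,V,I_o} and f_{U,V,I_•} are identities for all objects U, V. *)

(* Defs.v *)
From Stdlib Require Import FunctionalExtensionality.

Set Implicit Arguments.
Unset Strict Implicit.
Unset Printing Implicit Defensive.

(** * Categories, functors, representability *)

Record Category := {
  Ob :> Type;
  Hom : Ob -> Ob -> Type;
  idm : forall A, Hom A A;
  comp : forall A B D, Hom B D -> Hom A B -> Hom A D;
  comp_id_l : forall A B (f : Hom A B), comp (idm B) f = f;
  comp_id_r : forall A B (f : Hom A B), comp f (idm A) = f;
  comp_assoc : forall A B D E (f : Hom A B) (g : Hom B D) (h : Hom D E),
    comp h (comp g f) = comp (comp h g) f
}.

Arguments Hom {c} A B.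
Arguments idm {c} A.
Arguments comp {c A B D} g f.

Declare Scope cat_scope.
Open Scope cat_scope.

Notation "g ∘ f" := (comp g f) (at level 40, left associativity) : cat_scope.

Record Iso (C : Category) (A B : C) := {
  iso_hom :> Hom A B;
  iso_inv : Hom B A;
  iso_inv_hom : iso_inv ∘ iso_hom = idm A;
  iso_hom_inv : iso_hom ∘ iso_inv = idm B
}.

Definition opposite (C : Category) : Category := {|
  Ob := Ob C;
  Hom := fun A B => @Hom C B A;
  idm := fun A => @idm C A;
  comp := fun A B D g f => @comp C D B A f g;
  comp_id_l := fun A B f => @comp_id_r C B A f;
  comp_id_r := fun A B f => @comp_id_l C B A f;
  comp_assoc := fun A B D E f g h => eq_sym (@comp_assoc C E D B A h g f)
|}.

Definition SetCat : Category := {|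
  Ob := Type;
  Hom := fun A B => A -> B;
  idm := fun A x => x;
  comp := fun A B D g f x => g (f x);
  comp_id_l := fun A B f => eq_refl;
  comp_id_r := fun A B f => eq_refl;
  comp_assoc := fun A B D E f g h => eq_refl
|}.

Record Functor (C D : Category) := {
  fobj :> C -> D;
  fmap : forall A B : C, Hom A B -> Hom (fobj A) (fobj B);
  fmap_id : forall A : C, fmap (idm A) = idm (fobj A);
  fmap_comp : forall (A B E : C) (f : Hom A B) (g : Hom B E),
    fmap (g ∘ f) = fmap g ∘ fmap f
}.

Record NatIso (C D : Category) (F G : Functor C D) := {
  nat_component :> forall A : C, Iso (F A) (G A);
  nat_natural : forall (A B : C) (f : Hom A B),
    fmap G f ∘ nat_component A = nat_component B ∘ fmap F f
}.

(** Contravariant functors from [C] to sets. *)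
Definition Presheaf (C : Category) := Functor (opposite C) SetCat.

Lemma hom_to_id (C : Category) (X U : C) :
  (fun v : Hom U X => v ∘ idm U) = (fun v => v).
Proof. apply functional_extensionality; intro v; apply comp_id_r. Qed.

Lemma hom_to_comp (C : Category) (X A B D : C) (f : Hom B A) (g : Hom D B) :
  (fun v : Hom A X => v ∘ (f ∘ g)) = (fun v => (v ∘ f) ∘ g).
Proof. apply functional_extensionality; intro v; apply comp_assoc. Qed.

Definition hom_to (C : Category) (X : C) : Presheaf C := {|
  fobj := fun U : opposite C => (@Hom C U X : SetCat);
  fmap := fun (A B : opposite C) (f : @Hom C B A) (v : @Hom C A X) => v ∘ f;
  fmap_id := fun U => hom_to_id X U;
  fmap_comp := fun A B D f g => @hom_to_comp C X A B D f g
|}.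

Definition represented_by (C : Category) (F : Presheaf C) (X : C) : Prop :=
  inhabited (NatIso (hom_to X) F).

(** * Monoidal structures *)

Record Monoidal (C : Category) := {
  tens : C -> C -> C;
  tensm : forall A A' B B' : C,
    Hom A A' -> Hom B B' -> Hom (tens A B) (tens A' B');
  tensm_id : forall A B : C, tensm (idm A) (idm B) = idm (tens A B);
  tensm_comp : forall (A A' A'' B B' B'' : C)
      (f : Hom A A') (f' : Hom A' A'') (g : Hom B B') (g' : Hom B' B''),
    tensm (f' ∘ f) (g' ∘ g) = tensm f' g' ∘ tensm f g;

  unit_ob : C;
  assoc : forall A B D : C, Iso (tens (tens A B) D) (tens A (tens B D));
  lunit : forall A : C, Iso (tens unit_ob A) A;
  runit : forall A : C, Iso (tens A unit_ob) A;

  assoc_natural : forall (A A' B B' D D' : C)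
      (f : Hom A A') (g : Hom B B') (h : Hom D D'),
    tensm f (tensm g h) ∘ assoc A B D = assoc A' B' D' ∘ tensm (tensm f g) h;
  lunit_natural : forall (A A' : C) (f : Hom A A'),
    f ∘ lunit A = lunit A' ∘ tensm (idm unit_ob) f;
  runit_natural : forall (A A' : C) (f : Hom A A'),
    f ∘ runit A = runit A' ∘ tensm f (idm unit_ob);

  pentagon : forall A B D E : C,
    assoc A B (tens D E) ∘ assoc (tens A B) D E
    = tensm (idm A) (assoc B D E)
        ∘ assoc A (tens B D) E
        ∘ tensm (assoc A B D) (idm E);
  triangle : forall A B : C,
    tensm (idm A) (lunit B) ∘ assoc A unit_ob B = tensm (runit A) (idm B)
}.

(** * Quadratic categories *)

Section Quadratic.

(** [O] is the product usually written [o], and [M] the product [•]; a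
    priori they share no structure besides the category. *)
Variables (C : Category) (O M : Monoidal C).

Local Notation "U ⊙ V" := (tens O U V) (at level 35, right associativity).
Local Notation "U • V" := (tens M U V) (at level 35, right associativity).
Local Notation "u ⊙^ v" := (tensm O u v) (at level 35, right associativity).
Local Notation "u •^ v" := (tensm M u v) (at level 35, right associativity).
Local Notation Id := idm.
Local Notation I_o := (unit_ob O).
Local Notation I_m := (unit_ob M).

Record Quadratic := {
  dual : C -> C;
  qc : forall U : C, Hom I_m (U ⊙ dual U);
  qd : forall U : C, Hom (dual U • U) I_o;
  qf : forall U1 U2 U3 : C, Hom ((U1 ⊙ U2) • U3) (U1 ⊙ (U2 • U3));
  qh : forall U1 U2 U3 : C, Hom (U1 • (U2 ⊙ U3)) ((U1 • U2) ⊙ U3);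

  qh_qf : forall U1 U2 U3 U4 : C,
    qh U1 U2 (U3 • U4) ∘ (Id U1 •^ qf U2 U3 U4) ∘ assoc M U1 (U2 ⊙ U3) U4
    = qf (U1 • U2) U3 U4 ∘ (qh U1 U2 U3 •^ Id U4);

  qf_qh : forall U1 U2 U3 U4 : C,
    (Id U1 ⊙^ qh U2 U3 U4) ∘ qf U1 U2 (U3 ⊙ U4)
    = assoc O U1 (U2 • U3) U4 ∘ (qf U1 U2 U3 ⊙^ Id U4) ∘ qh (U1 ⊙ U2) U3 U4;

  (** In the two duality laws the identification of source and target with [U]
      (resp. its dual) is made by composing with the unit isomorphisms. *)
  dual_left : forall U : C,
    runit O U
      ∘ ((Id U ⊙^ qd U) ∘ qf U (dual U) U ∘ (qc U •^ Id U))
      ∘ iso_inv (lunit M U)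
    = Id U;

  dual_right : forall U : C,
    lunit O (dual U)
      ∘ ((qd U ⊙^ Id (dual U)) ∘ qh (dual U) U (dual U)
           ∘ (Id (dual U) •^ qc U))
      ∘ iso_inv (runit M (dual U))
    = Id (dual U);

  qh_natural : forall (U1 U1' U2 U2' U3 U3' : C)
      (u1 : Hom U1 U1') (u2 : Hom U2 U2') (u3 : Hom U3 U3'),
    qh U1' U2' U3' ∘ (u1 •^ (u2 ⊙^ u3)) = ((u1 •^ u2) ⊙^ u3) ∘ qh U1 U2 U3;

  qf_natural : forall (U1 U1' U2 U2' U3 U3' : C)
      (u1 : Hom U1 U1') (u2 : Hom U2 U2') (u3 : Hom U3 U3'),
    qf U1' U2' U3' ∘ ((u1 ⊙^ u2) •^ u3) = (u1 ⊙^ (u2 •^ u3)) ∘ qf U1 U2 U3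
}.

(** The identifications [V ⊙ I_o = V] and [V • I_m = V] turn [qh U V I_o] and
    [qf U V I_m] into identities.  This does not follow from [Quadratic]:
    the axioms there leave [qh U V I_o] and [qf U V I_m] free to be
    non-invertible, and the representability theorem then fails. *)
Record unit_compatible (Q : Quadratic) : Prop := {
  qh_unit : forall U V : C,
    runit O (U • V) ∘ qh Q U V I_o = Id U •^ runit O V;
  qf_unit : forall U V : C,
    (Id U ⊙^ runit M V) ∘ qf Q U V I_m = runit M (U ⊙ V)
}.

End Quadratic.

(** * The functor [U ↦ Hom (U • L) N] *)

Lemma hom_tens_id (C : Category) (M : Monoidal C) (L N U : C) :
  (fun v : Hom (tens M U L) N => v ∘ tensm M (idm U) (idm L)) = (fun v => v).
Proof.
apply functional_extensionality; intro v.
rewrite tensm_id; apply comp_id_r.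
Qed.

Lemma hom_tens_comp (C : Category) (M : Monoidal C) (L N A B D : C)
    (f : Hom B A) (g : Hom D B) :
  (fun v : Hom (tens M A L) N => v ∘ tensm M (f ∘ g) (idm L))
  = (fun v => (v ∘ tensm M f (idm L)) ∘ tensm M g (idm L)).
Proof.
apply functional_extensionality; intro v.
rewrite <- comp_assoc, <- tensm_comp, comp_id_l; reflexivity.
Qed.

Definition hom_tens (C : Category) (M : Monoidal C) (L N : C) : Presheaf C := {|
  fobj := fun U : opposite C => (@Hom C (tens M U L) N : SetCat);
  fmap := fun (A B : opposite C) (f : @Hom C B A)
              (v : @Hom C (tens M A L) N) => v ∘ tensm M f (idm L);
  fmap_id := fun U => hom_tens_id M L N U;
  fmap_comp := fun A B D f g => @hom_tens_comp C M L N A B D f g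
|}.

(* Main.v *)
Require Import Defs.
From Stdlib Require Import FunctionalExtensionality.

(** As for adjunctions, [qd] and [qc] play the roles of counit and unit.  In
    each composite of the two transposes, the interchange law between [qf] and
    [qh] moves the duality morphisms next to each other so that a duality law
    applies; what remains is absorbed by the unit axioms and the triangle. *)

Set Implicit Arguments.
Unset Strict Implicit.
Unset Printing Implicit Defensive.

(** Below, composites are kept nested to the right; this form applies an equation to two adjacent
    factors followed by a tail [x]. *)
Lemma comp_eq_assoc (C : Category) (X A B B' D : C) (g : Hom B D) (f : Hom A B)
    (g' : Hom B' D) (f' : Hom A B') (e : g ∘ f = g' ∘ f') (x : Hom X A) :
  g ∘ (f ∘ x) = g' ∘ (f' ∘ x).
Proof. rewrite !comp_assoc, e; reflexivity. Qed.

Lemma comp_assoc_eq (C : Category) (X A B D : C) (g : Hom B D) (f : Hom A B)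
    (k : Hom A D) (e : g ∘ f = k) (x : Hom X A) :
  g ∘ (f ∘ x) = k ∘ x.
Proof. rewrite comp_assoc, e; reflexivity. Qed.

Lemma comp_iso_inv_eq_id (C : Category) (A B : C) (i : Iso A B) (f : Hom A B) :
  f ∘ iso_inv i = idm B -> f = i.
Proof.
intro e.
rewrite <- (comp_id_r f), <- (iso_inv_hom i), comp_assoc, e.
apply comp_id_l.
Qed.

Section Tensor.

Variables (C : Category) (M : Monoidal C).

Lemma tensm_comp_id_r (A B D X : C) (f : Hom A B) (g : Hom B D) :
  tensm M (g ∘ f) (idm X) = tensm M g (idm X) ∘ tensm M f (idm X).
Proof. rewrite <- tensm_comp, comp_id_l; reflexivity. Qed.

Lemma tensm_comp_id_l (A B D X : C) (f : Hom A B) (g : Hom B D) :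
  tensm M (idm X) (g ∘ f) = tensm M (idm X) g ∘ tensm M (idm X) f.
Proof. rewrite <- tensm_comp, comp_id_l; reflexivity. Qed.

Lemma tensm_interchange (A A' B B' : C) (f : Hom A A') (g : Hom B B') :
  tensm M f (idm B') ∘ tensm M (idm A) g
  = tensm M (idm A') g ∘ tensm M f (idm B).
Proof. rewrite <- !tensm_comp, !comp_id_l, !comp_id_r; reflexivity. Qed.

Lemma runit_inv_natural (A A' : C) (f : Hom A A') :
  tensm M f (idm (unit_ob M)) ∘ iso_inv (runit M A) = iso_inv (runit M A') ∘ f.
Proof.
rewrite <- (comp_id_l (tensm M f _ ∘ _)), <- (iso_inv_hom (runit M A')).
rewrite <- !comp_assoc, (comp_assoc (iso_inv (runit M A))).
rewrite <- runit_natural, <- comp_assoc, iso_hom_inv, comp_id_r.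
reflexivity.
Qed.

End Tensor.

Section Transpose.

Variables (C : Category) (O M : Monoidal C) (Q : Quadratic O M).

Definition transpose_left (L N U : C) (v : Hom U (tens O N (dual Q L))) :
    Hom (tens M U L) N :=
  runit O N ∘ (tensm O (idm N) (qd Q L)
    ∘ (qf Q N (dual Q L) L ∘ tensm M v (idm L))).

Definition transpose_right (L N U : C) (w : Hom (tens M U L) N) :
    Hom U (tens O N (dual Q L)) :=
  tensm O w (idm (dual Q L)) ∘ (qh Q U L (dual Q L)
    ∘ (tensm M (idm U) (qc Q L) ∘ iso_inv (runit M U))).

Lemma transpose_left_natural (L N U V : C) (f : Hom V U)
    (v : Hom U (tens O N (dual Q L))) :
  transpose_left v ∘ tensm M f (idm L) = transpose_left (v ∘ f).
Proof.
unfold transpose_left.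
rewrite tensm_comp_id_r, <- !comp_assoc; reflexivity.
Qed.

(** [f] slides past the inverse unit isomorphism by its naturality, past [qc] by interchange and
    past [qh] by [qh_natural]. *)
Lemma transpose_right_natural (L N U V : C) (f : Hom V U)
    (w : Hom (tens M U L) N) :
  transpose_right w ∘ f = transpose_right (w ∘ tensm M f (idm L)).
Proof.
unfold transpose_right.
rewrite tensm_comp_id_r, <- !comp_assoc.
rewrite <- runit_inv_natural.
rewrite <- (comp_eq_assoc (tensm_interchange M f (qc Q L))).
rewrite <- (comp_eq_assoc (qh_natural Q f (idm L) (idm (dual Q L)))).
rewrite tensm_id; reflexivity.
Qed.

(** Naturality in the target object, used to reduce one round trip to an identity morphism. *)
Lemma transpose_left_postcomp (L N N' U : C) (u : Hom N N')
    (v : Hom U (tens O N (dual Q L))) :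
  u ∘ transpose_left v = transpose_left (tensm O u (idm (dual Q L)) ∘ v).
Proof.
unfold transpose_left.
rewrite tensm_comp_id_r.
rewrite (comp_eq_assoc (qf_natural Q u (idm (dual Q L)) (idm L))).
rewrite tensm_id, (comp_eq_assoc (eq_sym (tensm_interchange O u (qd Q L)))).
rewrite (comp_eq_assoc (runit_natural O u)); reflexivity.
Qed.

(** The duality law solved for the unit isomorphism, the form to which the triangle axiom
    applies. *)
Lemma dual_left_lunit (U : C) :
  runit O U ∘ (tensm O (idm U) (qd Q U)
    ∘ (qf Q U (dual Q U) U ∘ tensm M (qc Q U) (idm U))) = lunit M U.
Proof.
apply comp_iso_inv_eq_id.
rewrite (comp_assoc _ (qf Q _ _ _)); apply dual_left.
Qed.

Lemma dual_right_runit (U : C) :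
  lunit O (dual Q U) ∘ (tensm O (qd Q U) (idm (dual Q U))
    ∘ (qh Q (dual Q U) U (dual Q U) ∘ tensm M (idm (dual Q U)) (qc Q U)))
  = runit M (dual Q U).
Proof.
apply comp_iso_inv_eq_id.
rewrite (comp_assoc _ (qh Q _ _ _)); apply dual_right.
Qed.

Hypothesis HQ : unit_compatible Q.

Lemma transpose_left_right_id (L U : C) :
  transpose_left (transpose_right (idm (tens M U L))) = idm (tens M U L).
Proof.
unfold transpose_left, transpose_right.
rewrite tensm_id, comp_id_l, !tensm_comp_id_r.
(* Interchange trades [qf] after [qh] for [qh] after [qf], so that [qf] acts on [L] and its dual
   only, inside [Id U •^ _]. *)
rewrite (comp_assoc_eq (eq_sym (qh_qf Q U L (dual Q L) L))), <- !comp_assoc.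
rewrite (comp_assoc_eq (eq_sym
  (assoc_natural M (idm U) (qc Q L) (idm L)))), <- !comp_assoc.
(* Splitting the identity of [U • L] lets [qd] pass to the right of [qh], which leaves [qh U L I_o]
   for [qh_unit]. *)
rewrite <- (tensm_id M U L).
rewrite (comp_assoc_eq (eq_sym
  (qh_natural Q (idm U) (idm L) (qd Q L)))), <- !comp_assoc.
rewrite (comp_assoc_eq (qh_unit HQ U L)).
(* All factors between [runit O L] and [qc] now have the form [Id U •^ _]; merged, they are the left
   duality law for [L]. *)
rewrite !(comp_assoc_eq (eq_sym (tensm_comp_id_l M _ _ _))).
rewrite <- !comp_assoc, dual_left_lunit.
rewrite (comp_assoc_eq (triangle M U L)).
rewrite <- tensm_comp_id_r, iso_hom_inv; reflexivity.
Qed.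

Lemma transpose_right_left_id (L N : C) :
  transpose_right (transpose_left (idm (tens O N (dual Q L))))
  = idm (tens O N (dual Q L)).
Proof.
unfold transpose_left, transpose_right.
(* The triangle is used backwards: it creates the associator of [O] that the interchange law [qf_qh]
   consumes. *)
rewrite tensm_id, comp_id_r, !tensm_comp_id_r, <- triangle, <- !comp_assoc.
rewrite (comp_assoc_eq (eq_sym
  (assoc_natural O (idm N) (qd Q L) (idm (dual Q L))))), <- !comp_assoc.
rewrite (comp_assoc _ (qh Q _ _ _)).
rewrite (comp_assoc_eq (eq_trans (comp_assoc _ _ _)
  (eq_sym (qf_qh Q N (dual Q L) L (dual Q L))))), <- !comp_assoc.
(* Here [qc] passes to the left of [qf], which leaves [qf] at [I_m] for [qf_unit]. *)
rewrite <- (tensm_id O N (dual Q L)).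
rewrite (comp_assoc_eq (qf_natural Q (idm N) (idm (dual Q L)) (qc Q L))).
rewrite <- !comp_assoc.
rewrite !(comp_assoc_eq (eq_sym (tensm_comp_id_l O _ _ _))).
rewrite <- !comp_assoc, dual_right_runit.
rewrite (comp_assoc_eq (qf_unit HQ N (dual Q L))), iso_hom_inv.
symmetry; apply tensm_id.
Qed.

(** As in the Yoneda lemma, naturality in [N] reduces the claim to [w] the identity of [U • L]. *)
Lemma transpose_left_right (L N U : C) (w : Hom (tens M U L) N) :
  transpose_left (transpose_right w) = w.
Proof.
transitivity (w ∘ transpose_left (transpose_right (idm (tens M U L)))).
- rewrite transpose_left_postcomp.
  unfold transpose_right; rewrite tensm_id, comp_id_l; reflexivity.
- rewrite transpose_left_right_id; apply comp_id_r.
Qed.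

(** Here naturality in [U] reduces the claim to [v] an identity. *)
Lemma transpose_right_left (L N U : C) (v : Hom U (tens O N (dual Q L))) :
  transpose_right (transpose_left v) = v.
Proof.
transitivity (transpose_right (transpose_left (idm _ ∘ v))).
- rewrite comp_id_l; reflexivity.
- rewrite <- transpose_left_natural, <- transpose_right_natural.
  rewrite transpose_right_left_id; apply comp_id_l.
Qed.

End Transpose.

Theorem theorem2p2 (C : Category) (O M : Monoidal C) (Q : Quadratic O M)
    (HQ : unit_compatible Q) (L N : C) :
  represented_by (hom_tens M L N) (tens O N (dual Q L)).
Proof.
constructor.
unshelve refine (@Build_NatIso _ _ (hom_to (tens O N (dual Q L)))
  (hom_tens M L N) (fun U : opposite C => _) _).
- refine (@Build_Iso SetCat (@Hom C U (tens O N (dual Q L)))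
    (@Hom C (tens M U L) N) (fun v => transpose_left v)
    (fun w => transpose_right Q w) _ _);
    apply functional_extensionality; intro.
  + apply (transpose_right_left HQ).
  + apply (transpose_left_right HQ).
- intros U V f; apply functional_extensionality; intro v.
  apply (transpose_left_natural (C := C)).
Qed.
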